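(* Let $F$ be a free group of finite rank $k\ge 2$ and let $H\le Aut(F)$ be a finitely generated group of automorphisms of $F$ such that the image $H'$ of $H$ in $Aut(F_{ab})\cong GL(k,\mathbb Z)$ is non-amenable. Then for any finite generating set $S$ of $F$ and for any finite generating set $T$ of $H$ we have $\nu(H,T,S)>0$.
   Context: $F_{ab}$ is the abelianization of $F$. For $\phi\in Aut(F)$, $\|\phi\|_S:=\max_{s\in S}|\phi(s)|_S$, where $|\cdot|_S$ is word length with respect to $S$. For a noncyclic subgroup $H\le Aut(F)$ with finite generating set $T$, the number $\nu(H,T,S)\ge 0$ is the constant such that $\lim_{n\to\infty}\frac{\log\|\phi_n\|_S}{n}=\nu(H,T,S)$ almost surely and in $L^1$ (this constant exists), where $\phi_n$ is the non-backtracking simple random walk on the Cayley graph of $H$ with respect to $T$: $\phi_n=t_1t_2\cdots t_n\in H$, where $t_1t_2t_3\dots$ is a random semi-infinite freely reduced word over $T^{\pm1}$ (in the free group $F(T)$ with basis $T$), $t_1$ uniformly distributed on the $2\#T$ letters of $T^{\pm 1}$ and each $t_{i+1}$, conditionally on $t_1,\dots,t_i$, uniformly distributed on the $2\#T-1$ letters different from $t_i^{-1}$. *)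

(* Defs.v *)
From HB Require Import structures.
From mathcomp Require Import all_boot all_order all_algebra finmap.
From mathcomp Require Import all_classical all_reals all_analysis.
Set Implicit Arguments.
Unset Strict Implicit.
Unset Printing Implicit Defensive.
Import Order.TTheory GRing.Theory Num.Theory.
Import numFieldNormedType.Exports.
Local Open Scope quotient_scope.
Local Open Scope classical_set_scope.
Local Open Scope group_scope.

Section Subgroups.
Variable G : groupType.
Implicit Types (A H : set G) (x y : G).

Definition subgroup H : Prop := H 1 /\ forall x y, H x -> H y -> H (x / y).

Definition gen A : set G := smallest subgroup A.

Definition generates (T : {fset G}) H : Prop := gen [set` T] = H.

Definition finitely_generated H : Prop := exists T : {fset G}, generates T H.

Lemma gen_subgroup A : subgroup (gen A).
Proof.
split=> [K [[]] //|x y Hx Hy K KA].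
by case: (KA) => -[_ sK] _; apply: sK; [exact: Hx|exact: Hy].
Qed.

Lemma subgroupV H x : subgroup H -> H x -> H x^-1.
Proof. by case=> H1 HB Hx; rewrite -div1g; apply: HB. Qed.

Lemma subgroupM H x y : subgroup H -> H x -> H y -> H (x * y).
Proof.
by move=> sH Hx Hy; rewrite -(invgK y); apply: sH.2 => //; exact: subgroupV.
Qed.

End Subgroups.

(* Von Neumann's definition.  [mu A] is only meaningful for [A `<=` H]. *)
Definition amenable (R : realType) (G : groupType) (H : set G) : Prop :=
  exists mu : set G -> R,
    [/\ mu H = 1%R,
        forall A, A `<=` H -> (0 <= mu A)%R,
        forall A B, A `<=` H -> B `<=` H -> A `&` B = set0 ->
          mu (A `|` B) = (mu A + mu B)%R &
        forall h A, H h -> A `<=` H -> mu [set h * a | a in A] = mu A].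

Definition free_basis (F : groupType) (k : nat) (x : 'I_k -> F) : Prop :=
  forall (G : groupType) (f : 'I_k -> G),
    exists! h : F -> G,
      {morph h : u v / u * v} /\ forall i, h (x i) = f i.

Definition free_of_rank (F : groupType) (k : nat) : Prop :=
  exists x : 'I_k -> F, free_basis x.

Section Automorphisms.
Variable G : groupType.

Record aut := Aut {
  autfun :> G -> G;
  aut_bij : bijective autfun;
  autM : {morph autfun : x y / x * y} }.

HB.instance Definition _ := gen_eqMixin aut.
HB.instance Definition _ := gen_choiceMixin aut.

Lemma aut_ext (f g : aut) : f =1 g -> f = g.
Proof.
case: f g => [f bf Mf] [g bg Mg] /= /funext fg; subst g.
by congr Aut; exact: Prop_irrelevance.
Qed.

Lemma aut_invP (f : aut) : {g : G -> G | cancel f g /\ cancel g f}.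
Proof. by apply: cid; case: (aut_bij f) => g fK gK; exists g. Qed.

Definition aut_invf (f : aut) : G -> G := sval (aut_invP f).

Lemma aut_invfK (f : aut) : cancel f (aut_invf f).
Proof. by have [] := svalP (aut_invP f). Qed.

Lemma aut_invfVK (f : aut) : cancel (aut_invf f) f.
Proof. by have [] := svalP (aut_invP f). Qed.

Lemma aut_invfM (f : aut) : {morph aut_invf f : x y / x * y}.
Proof.
by move=> x y; apply: (bij_inj (aut_bij f)); rewrite autM !aut_invfVK.
Qed.

Definition aut_one : aut :=
  @Aut id (Bijective (fun=> erefl) (fun=> erefl)) (fun _ _ => erefl).

Definition aut_inv (f : aut) : aut :=
  Aut (Bijective (aut_invfVK f) (aut_invfK f)) (@aut_invfM f).

Lemma aut_compM (f g : aut) : {morph f \o g : x y / x * y}.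
Proof. by move=> x y /=; rewrite !autM. Qed.

(* Automorphisms act on the left: [(f * g) x = f (g x)]. *)
Definition aut_mul (f g : aut) : aut :=
  Aut (bij_comp (aut_bij f) (aut_bij g)) (@aut_compM f g).

Lemma aut_mulA : associative aut_mul.
Proof. by move=> f g h; exact: aut_ext. Qed.

Lemma aut_mul1 : left_id aut_one aut_mul.
Proof. by move=> f; exact: aut_ext. Qed.

Lemma aut_mulr1 : right_id aut_one aut_mul.
Proof. by move=> f; exact: aut_ext. Qed.

Lemma aut_mulV : left_inverse aut_one aut_inv aut_mul.
Proof. by move=> f; apply: aut_ext => x; exact: aut_invfK. Qed.

Lemma aut_mulrV : right_inverse aut_one aut_inv aut_mul.
Proof. by move=> f; apply: aut_ext => x; exact: aut_invfVK. Qed.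

HB.instance Definition _ :=
  isGroup.Build aut aut_mulA aut_mul1 aut_mulr1 aut_mulV aut_mulrV.

End Automorphisms.

Section Abelianization.
Variable G : groupType.

Definition derived : set G := gen [set [~ x, y] | x in setT & y in setT].

Lemma derived_subgroup : subgroup derived.
Proof. exact: gen_subgroup. Qed.

Lemma derived_comm (x y : G) : derived [~ x, y].
Proof. by move=> K [_]; apply; exists x => //; exists y. Qed.

Lemma derivedJ (x y : G) : derived x -> derived (x ^ y).
Proof.
move=> Dx; rewrite -[x ^ y](mulVKg x).
by apply: (subgroupM derived_subgroup) => //; exact: derived_comm.
Qed.

Definition ab_rel (x y : G) : bool := `[< derived (x^-1 * y) >].

Lemma ab_relP (x y : G) : reflect (derived (x^-1 * y)) (ab_rel x y).
Proof. exact: asboolP. Qed.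

Lemma ab_rel_refl : reflexive ab_rel.
Proof. by move=> x; apply/ab_relP; rewrite mulVg; case: derived_subgroup. Qed.

Lemma ab_rel_sym : symmetric ab_rel.
Proof.
have sym x y : ab_rel x y -> ab_rel y x.
  move=> /ab_relP /(subgroupV derived_subgroup).
  by rewrite invgM invgK => ?; apply/ab_relP.
by move=> x y; apply/idP/idP; exact: sym.
Qed.

Lemma ab_rel_trans : transitive ab_rel.
Proof.
move=> y x z /ab_relP xy /ab_relP yz; apply/ab_relP.
have := subgroupM derived_subgroup xy yz.
by rewrite -mulgA mulVKg.
Qed.

Canonical ab_equiv := EquivRel ab_rel ab_rel_refl ab_rel_sym ab_rel_trans.

Definition abelianization := {eq_quot ab_equiv}.

HB.instance Definition _ := Choice.on abelianization.
HB.instance Definition _ := Quotient.on abelianization.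
HB.instance Definition _ := EqQuotient.on abelianization.

Definition ab (x : G) : abelianization := \pi_abelianization x.

Lemma ab_repr (a : abelianization) : ab (repr a) = a.
Proof. exact: reprK. Qed.

Lemma abP (x y : G) : ab x = ab y <-> derived (x^-1 * y).
Proof.
split=> [/eqP|/ab_relP xy]; rewrite /ab.
  by rewrite eqquotE => /ab_relP.
by apply/eqP; rewrite eqquotE.
Qed.

Definition ab_one : abelianization := ab 1.
Definition ab_inv (a : abelianization) : abelianization := ab (repr a)^-1.
Definition ab_mul (a b : abelianization) : abelianization :=
  ab (repr a * repr b).

Lemma ab_mulE (x y : G) : ab_mul (ab x) (ab y) = ab (x * y).
Proof.
apply/abP; set x' := repr _; set y' := repr _.
have /abP Dx : ab x' = ab x by exact: ab_repr.
have /abP Dy : ab y' = ab y by exact: ab_repr.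
have -> : (x' * y')^-1 * (x * y) = ((x'^-1 * x) ^ y') * (y'^-1 * y).
  by rewrite /conjg invgM -!mulgA mulVKg.
by apply: (subgroupM derived_subgroup) => //; exact: derivedJ.
Qed.

Lemma ab_invE (x : G) : ab_inv (ab x) = ab x^-1.
Proof.
apply/abP; set x' := repr _.
have /abP Dx : ab x = ab x' by rewrite ab_repr.
have -> : (x'^-1)^-1 * x^-1 = (x^-1 * x') ^ x^-1.
  by rewrite /conjg !invgK !mulgA mulgV mul1g.
exact: derivedJ.
Qed.

Lemma ab_mulA : associative ab_mul.
Proof.
move=> a b c; rewrite -(ab_repr a) -(ab_repr b) -(ab_repr c).
by rewrite !ab_mulE mulgA.
Qed.

Lemma ab_mul1 : left_id ab_one ab_mul.
Proof. by move=> a; rewrite -(ab_repr a) ab_mulE mul1g. Qed.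

Lemma ab_mulr1 : right_id ab_one ab_mul.
Proof. by move=> a; rewrite -(ab_repr a) ab_mulE mulg1. Qed.

Lemma ab_mulV : left_inverse ab_one ab_inv ab_mul.
Proof. by move=> a; rewrite -(ab_repr a) ab_invE ab_mulE mulVg. Qed.

Lemma ab_mulrV : right_inverse ab_one ab_inv ab_mul.
Proof. by move=> a; rewrite -(ab_repr a) ab_invE ab_mulE mulgV. Qed.

HB.instance Definition _ :=
  isGroup.Build abelianization ab_mulA ab_mul1 ab_mulr1 ab_mulV ab_mulrV.

Lemma abM : {morph ab : x y / x * y}.
Proof. by move=> x y; rewrite -ab_mulE. Qed.

End Abelianization.

Section InducedAutomorphism.
Variable G : groupType.

Lemma aut1 (f : aut G) : f 1 = 1.
Proof. by apply: (mulgI (f 1)); rewrite -autM !mulg1. Qed.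

Lemma autV (f : aut G) (x : G) : f x^-1 = (f x)^-1.
Proof. by apply: (mulgI (f x)); rewrite -autM !mulgV aut1. Qed.

Lemma derived_aut (f : aut G) (x : G) : derived x -> derived (f x).
Proof.
move=> Dx; apply: (Dx [set y | derived (f y)]); split=> [|_ [y _ [z _ <-]]] /=.
  have [D1 DB] := derived_subgroup G; split=> [|y z /= Dy Dz].
    by have := D1; rewrite -{1}(aut1 f).
  by rewrite autM autV; exact: DB.
rewrite /commg /conjg !autM !autV.
exact: derived_comm.
Qed.

(* The automorphism [ab x |-> ab (f x)], see [aut_abE]. *)
Definition aut_ab_fun (f : aut G) (a : abelianization G) : abelianization G :=
  ab (f (repr a)).

Lemma aut_ab_funE (f : aut G) (x : G) : aut_ab_fun f (ab x) = ab (f x).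
Proof.
apply/abP; rewrite -autV -autM; apply: derived_aut.
by apply/abP; exact: ab_repr.
Qed.

Lemma aut_ab_funM (f : aut G) : {morph aut_ab_fun f : x y / x * y}.
Proof.
move=> a b; rewrite -(ab_repr a) -(ab_repr b) -abM !aut_ab_funE.
by rewrite autM abM.
Qed.

Lemma aut_ab_fun_bij (f : aut G) : bijective (aut_ab_fun f).
Proof.
exists (aut_ab_fun (aut_inv f)) => a; rewrite -(ab_repr a) !aut_ab_funE /=.
  by rewrite aut_invfK.
by rewrite aut_invfVK.
Qed.

Definition aut_ab (f : aut G) : aut (abelianization G) :=
  Aut (aut_ab_fun_bij f) (@aut_ab_funM f).

Lemma aut_abE (f : aut G) (x : G) : aut_ab f (ab x) = ab (f x).
Proof. exact: aut_ab_funE. Qed.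

End InducedAutomorphism.

Section Words.
Variable G : groupType.
Implicit Type T : {fset G}.

(* The [2 * #T] formal letters [t] and [t^-1], [t \in T]: [(t, true)] stands
   for [t^-1], and is distinct from every [(u, false)] even if [t^-1] is in
   [T]. *)
Definition letter T : Type := (T * bool)%type.

HB.instance Definition _ T := Finite.on (letter T).

Definition letter_inv T (a : letter T) : letter T := (a.1, ~~ a.2).

Definition letter_val T (a : letter T) : G :=
  if a.2 then (val a.1)^-1 else val a.1.

Definition word_val T (w : seq (letter T)) : G := \prod_(a <- w) letter_val a.

(* Junk value [0] if [g] is not in the subgroup generated by [T]. *)
Definition word_length T (g : G) : nat :=
  xget 0%N [set n | (exists2 w : seq (letter T), size w = n & word_val w = g)
            /\ forall w : seq (letter T), word_val w = g -> (n <= size w)%N].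

Definition aut_norm (S : {fset G}) (f : aut G) : nat :=
  \max_(s : S) word_length S (f (val s)).

End Words.

Local Open Scope ereal_scope.

Section RandomWalk.
Variables (R : realType) (G : groupType) (T : {fset G}).
Variables (d : measure_display) (Omega : measurableType d).
Variable P : probability Omega R.

(* [t n] is the letter of index [n + 1].  The last clause is the transition
   law multiplied by the probability of the conditioning event, so that it also
   makes sense for words of probability 0. *)
Definition nonbacktracking_letters (t : nat -> Omega -> letter T) : Prop :=
  [/\ forall n a, measurable (t n @^-1` [set a]),
      forall a, P (t 0%N @^-1` [set a]) = ((2 * #|` T|)%:R^-1)%R%:E &
      forall n (w : nat -> letter T) (b : letter T),
        P [set om | (forall i, (i <= n)%N -> t i om = w i) /\ t n.+1 om = b] =
        (if b == letter_inv (w n) then 0%R else (2 * #|` T| - 1)%:R^-1)%R%:E *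
        P [set om | forall i, (i <= n)%N -> t i om = w i]].

Definition walk (t : nat -> Omega -> letter T) (n : nat) (om : Omega) : G :=
  \prod_(0 <= i < n) letter_val (t i om).

End RandomWalk.

(* [nu] is the growth constant of the walk [t]: the limit of
   [log ||phi_n||_S / n] almost surely and in L^1. *)
Definition growth_constant (R : realType) (F : groupType)
    (T : {fset aut F}) (S : {fset F})
    (d : measure_display) (Omega : measurableType d) (P : probability Omega R)
    (t : nat -> Omega -> letter T) (nu : R) : Prop :=
  let X n om := (ln (aut_norm S (walk t n om))%:R / n%:R)%R : R in
  {ae P, forall om, X^~ om @ \oo --> nu} /\
  (fun n => \int[P]_om (`|X n om - nu|%R)%:E) @ \oo --> 0.

(* Main.v *)
Require Import Defs.
From mathcomp Require Import all_boot all_order all_algebra finmap.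
From mathcomp Require Import all_classical all_reals all_analysis.
From HB Require Import structures.
From mathcomp Require Import measurable_realfun ring lra.

(* Let [M_n] be the automorphism of [F_ab] induced by [phi_n] and let
   [p_n (a, x)] be the probability that [t_n = a] and [M_n^-1 = x].  With
   [2 #T = q + 1], one step of the walk lowers the squared ell^2-norm of [p_n]
   by exactly [(1 - q^-2)] times its variance over the letter [a].  If two
   consecutive steps lower it only by a small proportion, then the sum of the
   means over [a] of [p_n] and [p_{n+1}] is almost invariant in ell^2, and its
   square gives an almost invariant probability measure.  So non-amenability of
   [H'] forces [||p_n||^2] to decay exponentially, and by Cauchy-Schwarz [M_n]
   cannot stay with probability [1/2] in sets of subexponential size.  But the
   automorphisms of [F_ab] induced by [phi] with [||phi||_S <= N] are at most
   polynomially many in [N], so [||phi_n||_S] grows exponentially.  The case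
   [#T = 1], where [q = 1] and the energy is conserved, is excluded because
   cyclic groups are amenable. *)

Set Implicit Arguments.
Unset Strict Implicit.
Unset Printing Implicit Defensive.
Import Order.TTheory GRing.Theory Num.Theory.
Import numFieldNormedType.Exports.
Local Open Scope classical_set_scope.
Local Open Scope ring_scope.

(** * Sums of finitely supported functions over a group *)

Section FiniteSupport.
Variables (R : realType) (G : groupType).
Implicit Types (f g : G -> R) (x y : G).

Definition finitely_supported f :=
  exists D : {fset G}, forall x, x \notin D -> f x = 0.

Lemma finitely_supported_shift f y :
  finitely_supported f -> finitely_supported (fun x => f (y * x)%g).
Proof.
case=> D fD; exists [fset (y^-1 * x)%g | x in D]%fset => x xD.
apply: fD; apply: contra xD => yxD; apply/imfsetP; exists (y * x)%g => //.
by rewrite mulKg.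
Qed.

Lemma finitely_supported_lift2 (F : R -> R -> R) f g : F 0 0 = 0 ->
  finitely_supported f -> finitely_supported g ->
  finitely_supported (fun x => F (f x) (g x)).
Proof.
move=> F0 [D fD] [E gE]; exists (D `|` E)%fset => x.
by rewrite in_fsetU negb_or => /andP[xD xE]; rewrite fD// gE.
Qed.

Lemma fsum_shift f y :
  \sum_(x \in [set: G]) f (y * x)%g = \sum_(x \in [set: G]) f x.
Proof.
rewrite [RHS](reindex_fsbigT (fun x => (y * x)%g))//.
by exists (fun x => (y^-1 * x)%g) => x; rewrite ?mulKg ?mulVKg.
Qed.

Lemma fsumD f g : finitely_supported f -> finitely_supported g ->
  \sum_(x \in [set: G]) (f x + g x) =
  \sum_(x \in [set: G]) f x + \sum_(x \in [set: G]) g x.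
Proof.
move=> [D fD] [E gE].
rewrite 3?(fsbigTE (D `|` E)%fset) -?big_split// => x;
  rewrite in_fsetU negb_or => /andP[xD xE]; rewrite ?fD ?gE ?addr0//.
Qed.

Lemma ler_fsum f g : finitely_supported f -> finitely_supported g ->
  (forall x, f x <= g x) ->
  \sum_(x \in [set: G]) f x <= \sum_(x \in [set: G]) g x.
Proof.
move=> [D fD] [E gE] fg.
rewrite 2?(fsbigTE (D `|` E)%fset); first by apply: ler_sum.
all: by move=> x; rewrite in_fsetU negb_or => /andP[xD xE]; rewrite ?fD ?gE.
Qed.

Lemma fsum_sum (I : finType) (f : I -> G -> R) :
  (forall i, finitely_supported (f i)) ->
  \sum_(x \in [set: G]) \sum_i f i x = \sum_i \sum_(x \in [set: G]) f i x.
Proof.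
move=> fs; have [D fD] := choice fs.
pose E := (\bigcup_(i in I) D i)%fset.
have fE i x : x \notin E -> f i x = 0.
  move=> xE; apply: fD; apply: contra xE => xD.
  by apply/bigfcupP; exists i => //; rewrite mem_index_enum.
rewrite (fsbigTE E); last by move=> x xE; rewrite big1// => i _; exact: fE.
rewrite exchange_big/=; apply: eq_bigr => i _.
by rewrite (fsbigTE E)// => x; exact: fE.
Qed.

End FiniteSupport.

(** * Amenability from almost invariant vectors *)

Lemma ultra_fmap (T U : Type) (f : T -> U) (F : set_system T) :
  UltraFilter F -> UltraFilter (f @ F).
Proof.
move=> FU; split; first exact: fmap_proper_filter.
move=> K KF FK; apply/seteqP; split=> // A KA.
have [//|FnA] := in_ultra_setVsetC (f @^-1` A) FU.
have KnA : K (~` A) by exact: FK.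
by have /filter_ex [? []] : K (A `&` ~` A) by exact: filterI.
Qed.

Section Reiter.
Variables (R : realType) (G : groupType) (L : finType) (v : L -> G).
Implicit Types (f g : G -> R) (A B H : set G).

Let mass A (f : G -> R) : R := \sum_(x \in [set: G]) \1_A x * f x.

Let finsM A (f : G -> R) : finitely_supported f ->
  finitely_supported (fun x => \1_A x * f x).
Proof. by case=> D fD; exists D => x xD; rewrite fD// mulr0. Qed.

Let finsX (f : G -> R) n : finitely_supported f ->
  finitely_supported (fun x => f x ^+ n.+1).
Proof. by case=> D fD; exists D => x xD; rewrite fD// expr0n. Qed.

(* The squares of almost invariant vectors of ell^2 give almost invariant
   probability measures; the mean is their limit along an ultrafilter. *)
Lemma amenable_almost_invariant H :
  H `<=` gen (range v) ->
  (forall eta : R, 0 < eta -> exists psi : G -> R,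
    [/\ finitely_supported psi, forall x, psi x != 0 -> H x,
        0 < \sum_(x \in [set: G]) psi x ^+ 2 &
        forall b, \sum_(x \in [set: G]) (psi (v b * x)%g - psi x) ^+ 2 <=
          eta * \sum_(x \in [set: G]) psi x ^+ 2]) ->
  amenable R H.
Proof.
move=> Hgen psiP.
(* The tolerance is the square of [1/(n+1)], because passing from vectors to their squares costs a
   square root. *)
have /choice[psi {}psiP] : forall n : nat, exists f : G -> R,
    [/\ finitely_supported f, forall x, f x != 0 -> H x,
        0 < \sum_(x \in [set: G]) f x ^+ 2 &
        forall b, \sum_(x \in [set: G]) (f (v b * x)%g - f x) ^+ 2 <=
          n.+1%:R^-1 ^+ 2 * \sum_(x \in [set: G]) f x ^+ 2].
  by move=> n; apply: psiP; rewrite exprn_gt0// invr_gt0.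
have psif n : finitely_supported (psi n) by case: (psiP n).
pose N n := \sum_(x \in [set: G]) psi n x ^+ 2.
have N0 n : 0 < N n by case: (psiP n).
pose m A n := mass A (fun x => psi n x ^+ 2) / N n.
have mH n : m H n = 1.
  rewrite /m [X in X / _](_ : _ = N n) ?divff ?gt_eqF//.
  apply: eq_fsbigr => x _; rewrite indicE.
  have [|] := eqVneq (psi n x) 0; first by move=> ->; rewrite expr0n mulr0.
  by case: (psiP n) => _ + _ _ => /[apply] Hx; rewrite mem_set// mul1r.
have m0 A n : 0 <= m A n.
  apply: divr_ge0; last exact: ltW.
  by apply: fsumr_ge0 => x _; rewrite mulr_ge0// sqr_ge0.
have m1 A n : m A n <= 1.
  rewrite /m ler_pdivrMr ?mul1r//; apply: ler_fsum.
  - exact/finsM/finsX.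
  - exact/finsX.
  - by move=> x; rewrite ler_piMl ?sqr_ge0// indicE; case: (_ \in _).
have mU A B n : A `&` B = set0 -> m (A `|` B) n = m A n + m B n.
  move=> AB; rewrite /m -mulrDl; congr (_ / _).
  rewrite -fsumD; [|exact/finsM/finsX|exact/finsM/finsX].
  apply: eq_fsbigr => x _; rewrite -mulrDl; congr (_ * _).
  rewrite !indicE in_setU -natrD; congr (_%:R).
  have : ~ (A x /\ B x) by move=> ABx; have : (A `&` B) x by []; rewrite AB.
  case: (boolP (x \in A)) => [/set_mem ?|_];
    by case: (boolP (x \in B)) => [/set_mem ?|_] // [].
have mv b A n : `|m [set v b * a | a in A]%g n - m A n| <= 3 * n.+1%:R^-1.
  have -> : m [set v b * a | a in A]%g n =
      mass A (fun x => psi n (v b * x)%g ^+ 2) / N n.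
    congr (_ / _); rewrite /mass -(fsum_shift _ (v b)).
    apply: eq_fsbigr => x _; congr (_ * _); rewrite !indicE.
    congr ((_ : bool)%:R); apply/idP/idP; rewrite !inE.
      by case=> a Aa /mulgI <-.
    by move=> Ax; exists x.
  rewrite /m -mulrBl normrM normfV (gtr0_norm (N0 n)) ler_pdivrMr//.
  set t : R := n.+1%:R^-1; have t0 : 0 < t by rewrite invr_gt0.
  (* With [p], [q] the values of [psi n] at [v b * x] and [x], [g] dominates [|p^2 - q^2|], by [2 |p
     - q| |p + q| <= t^-1 (p - q)^2 + t (p + q)^2] and [(p + q)^2 <= 2 p^2 + 2 q^2]. Its sum is at
     most [(5/2) t N n]. *)
  pose g x := 2^-1 * (t * (2 * psi n (v b * x)%g ^+ 2) + (t * (2 * psi n x ^+ 2) +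
     t^-1 * (psi n (v b * x)%g - psi n x) ^+ 2)).
  have fs1 : finitely_supported (fun x => psi n (v b * x)%g).
    exact: finitely_supported_shift.
  have fs2 : finitely_supported (fun x => psi n (v b * x)%g ^+ 2) by exact: finsX.
  have fs3 : finitely_supported (fun x => psi n x ^+ 2) by exact: finsX.
  have fs4 : finitely_supported
      (fun x => (psi n (v b * x)%g - psi n x) ^+ 2).
    apply: (@finitely_supported_lift2 _ _ (fun a c => (a - c) ^+ 2)) => //.
    by rewrite subrr expr0n.
  have fsZ (c : R) f : finitely_supported f ->
      finitely_supported (fun x => c * f x).
    by case=> D fD; exists D => x xD; rewrite fD// mulr0.
  have fsD f h : finitely_supported f -> finitely_supported h ->
      finitely_supported (fun x => f x + h x).
    by apply: (@finitely_supported_lift2 _ _ +%R); rewrite addr0.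
  have gE : \sum_(x \in [set: G]) g x <= 3 * t * N n.
    have sum2 : \sum_(x \in [set: G]) t * (2 * psi n x ^+ 2) = t * (2 * N n).
      by rewrite /N !mulr_fsumr.
    have shift2 :
        \sum_(x \in [set: G]) t * (2 * psi n (v b * x)%g ^+ 2) = t * (2 * N n).
      by rewrite (fsum_shift (fun x => t * (2 * psi n x ^+ 2))).
    rewrite (_ : \sum_(x \in [set: G]) g x = 2^-1 * (t * (2 * N n) +
        (t * (2 * N n) + t^-1 *
         \sum_(x \in [set: G]) (psi n (v b * x)%g - psi n x) ^+ 2))); last first.
      rewrite -{1}shift2 -sum2 [t^-1 * _]mulr_fsumr -fsumD; [|exact/fsZ/fsZ|exact/fsZ].
      by rewrite -fsumD ?mulr_fsumr//; [exact/fsZ/fsZ|exact/fsD/fsZ/fs4/fsZ/fsZ].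
    have [_ _ _ /(_ b)] := psiP n; rewrite -/(N n) -/t => h.
    have : t^-1 * \sum_(x \in [set: G]) (psi n (v b * x)%g - psi n x) ^+ 2 <=
       t * N n.
      by rewrite mulrC ler_pdivrMr// mulrAC -expr2.
    have := N0 n; nra.
  apply: le_trans gE.

  have gb x : `|psi n (v b * x)%g ^+ 2 - psi n x ^+ 2| <= g x.
    rewrite /g ler_norml; set p := psi n _; set q := psi n x.
    have tV : t * t^-1 = 1 by rewrite divff// gt_eqF.
    (* The signs [e = 1] and [e = -1] give the two halves of the bound on the absolute value. *)
    have sq (e : R) : 0 <= t^-1 * (e * (p - q) + t * (p + q)) ^+ 2.
      by rewrite mulr_ge0// ?sqr_ge0// invr_ge0 ltW.
    have sqE (e : R) : t^-1 * (e * (p - q) + t * (p + q)) ^+ 2 =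
        e ^+ 2 * (t^-1 * (p - q) ^+ 2) + e * 2 * (t * t^-1) * (p ^+ 2 - q ^+ 2)
        + t * (t * t^-1) * (p + q) ^+ 2 by ring.
    have := sq 1; have := sq (-1); rewrite !sqE tV.
    set X := t^-1 * _ => h1 h2.
    have : 0 <= t * (p - q) ^+ 2 by rewrite mulr_ge0// ?sqr_ge0// ltW.
    by nra.
  have fsg : finitely_supported g.
    by apply/fsZ/fsD; [exact/fsZ/fsZ|apply: fsD; [exact/fsZ/fsZ|exact/fsZ]].
  have le f h : finitely_supported f -> finitely_supported h ->
      (forall x, `|f x - h x| <= g x) ->
      mass A f <= mass A h + \sum_(x \in [set: G]) g x.
    move=> ff fh fhg; rewrite -fsumD//; last exact: finsM.
    apply: ler_fsum; [exact: finsM|by apply: fsD => //; exact: finsM|move=> x].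
    have := fhg x; rewrite ler_norml indicE => /andP[].
    by case: (_ \in _) => /=; rewrite ?mul1r ?mul0r; lra.
  rewrite ler_distlC; apply/andP; split.
    by rewrite lerBlDr; apply: le.
  by apply: le => // x; rewrite distrC.
(* Every [m A] takes values in the compact interval [[0, 1]], so it converges along an ultrafilter
   finer than the eventual filter. *)
have [U [UU FU]] := ultraFilterLemma (@eventually_filter : ProperFilter \oo).
have cvgm A : cvg (m A @ U).
  have := @segment_compact R 0 1; rewrite compact_ultra => /(_ (m A @ U)) [].
  - exact: ultra_fmap.
  - suff : U (m A @^-1` `[0, 1]%classic) by [].
    by apply: filterS filterT => n _ /=; rewrite in_itv/= m0 m1.
  - by move=> l [_ ml]; apply/cvg_ex; exists l.
exists (fun A => lim (m A @ U)); split.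
- by rewrite (_ : m H = cst 1) ?lim_cst//; apply/funext => n; exact: mH.
- by move=> A _; apply: limr_ge => //; apply: nearW.
- move=> A B _ _ AB.
  have -> : m (A `|` B) = m A \+ m B by apply/funext => n; exact: mU.
  by rewrite limD.
(* The elements that preserve the limit form a subgroup; closure under [x / y] is tested on the
   translate of [A] by [y^-1]. This leaves only the generators [v b], for which [mv] applies. *)
pose K := [set h | forall A, lim (m [set h * a | a in A]%g @ U) = lim (m A @ U)].
suff HK : H `<=` K by move=> h A /HK.
apply: subset_trans Hgen _; apply: smallest_sub => [|_ [b _ <-] A].
  split=> [A|x y Kx Ky A]; first by under eq_imagel do rewrite mul1g; rewrite image_id.
  have := Kx [set y^-1 * a | a in A]%g; have := Ky [set y^-1 * a | a in A]%g.
  rewrite !image_comp; under eq_imagel do rewrite /= mulVKg.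
  rewrite image_id => ->; under eq_imagel do rewrite /= mulgA.
  by [].
apply/eqP; rewrite -subr_eq0 -limB//; apply/eqP.
apply: (@cvg_lim _ _ _ U) => //.
suff : (fun n => m [set v b * a | a in A]%g n - m A n) @ \oo --> (0 : R).
  by apply: cvg_trans => ?; exact: FU.
apply: norm_cvg0.
apply: (@squeeze_cvgr _ _ _ _ (fun=> 0) (fun n => 3 * n.+1%:R^-1)).
- by near=> n; rewrite normr_ge0 mv.
- exact: cvg_cst.
- rewrite -[X in _ --> X](mulr0 3); apply: cvgM; first exact: cvg_cst.
  exact: cvg_harmonic.
Unshelve. all: by end_near.
Qed.
End Reiter.

(** * Amenability of cyclic groups *)

Lemma sum_fsum1 (R : realType) (G : groupType) (c : G) :
  \sum_(x \in [set: G]) ((x == c)%:R : R) = 1.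
Proof.
rewrite (fsbigTE [fset c]%fset) ?big_seq_fset1 ?eqxx// => x.
by rewrite in_fset1 => /negbTE->.
Qed.

(** The powers [g^0, ..., g^(N-1)] are Folner sets. The function [psi] counts them with
    multiplicity, which treats finite and infinite order alike. Translation by [g] changes it only
    at the two ends, by telescoping, while its squared norm is at least [N]. *)
Lemma cyclic_amenable (R : realType) (G : groupType) (H : set G) (g : G) :
  subgroup H -> H g -> H `<=` gen [set g] -> amenable R H.
Proof.
move=> sH Hg Hgen; apply: (@amenable_almost_invariant R G unit (fun=> g)).
  rewrite (_ : range _ = [set g])//; apply/seteqP.
  by split=> [_ [u _ <-]|_ ->] //; exists tt.
move=> eta eta0.
have [N N2] : exists N : nat, 2 <= eta * N%:R.
  exists (Num.bound (2 / eta)); rewrite mulrC -ler_pdivrMr//.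
  by rewrite ltW// archi_boundP// divr_ge0// ltW.
pose psi x : R := \sum_(i < N) (x == (g ^+ i)%g)%:R.
have gi (i : nat) : H (g ^+ i)%g.
  elim: i => [|i ih]; first by rewrite expg0; case: sH.
  by rewrite expgS; apply: subgroupM.
have psif : finitely_supported psi.
  exists [fset (g ^+ (i : 'I_N))%g | i in 'I_N]%fset => x xD; rewrite /psi big1// => i _.
  by case: eqP xD => // -> /imfsetP[]; exists i.
have fs2 : finitely_supported (fun x => psi x ^+ 2).
  by case: psif => D fD; exists D => x /fD->; rewrite expr0n.
have psi_sum : \sum_(x \in [set: G]) psi x = N%:R.
  rewrite fsum_sum; last first.
    by move=> i; exists [fset (g ^+ i)%g]%fset => x; rewrite in_fset1 => /negbTE->.
  by under eq_bigr do rewrite sum_fsum1; rewrite sumr_const card_ord.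
(* The values of [psi] are natural numbers, so [psi x <= psi x ^+ 2]. *)
have psi2 : N%:R <= \sum_(x \in [set: G]) psi x ^+ 2.
  rewrite -psi_sum; apply: ler_fsum => // x.
  rewrite /psi -natr_sum -natrX ler_nat.
  by case: (\sum_(i < N) _)%N => // n; rewrite leq_pmull.
have N0 : 0 < N%:R :> R by rewrite -(pmulr_rgt0 _ eta0) (lt_le_trans _ N2).
exists psi; split => //.
- move=> x; apply: contraNP => nHx; apply/eqP; rewrite /psi big1// => i _.
  by case: eqP => // xE; case: nHx; rewrite xE.
- exact: lt_le_trans psi2.
move=> _; apply: (@le_trans _ _ 2); last first.
  by apply: le_trans N2 _; rewrite ler_pM2l.
have fs1 (c : G) : finitely_supported (fun x => (x == c)%:R : R).
  by exists [fset c]%fset => x; rewrite in_fset1 => /negbTE->.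
have -> : 2 = \sum_(x \in [set: G]) ((x == g^-1%g)%:R + (x == (g^-1 * g ^+ N)%g)%:R : R).
  by rewrite fsumD// !sum_fsum1.
apply: ler_fsum.
- apply: (@finitely_supported_lift2 _ _ (fun a c => (a - c) ^+ 2)) => //.
    by rewrite subrr expr0n.
  exact: finitely_supported_shift.
- by apply: finitely_supported_lift2 => //; rewrite addr0.
move=> x.
have -> : psi (g * x)%g - psi x = (x == g^-1%g)%:R - (x == (g^-1 * g ^+ N)%g)%:R.
  have gx y : (g * x == y)%g = (x == g^-1 * y)%g.
    by apply/eqP/eqP => [<-|->]; rewrite ?mulKg ?mulVKg.
  pose F i : R := (x == (g^-1 * g ^+ i)%g)%:R.
  have -> : psi (g * x)%g = \sum_(i < N) F i by apply: eq_bigr => i _; rewrite gx.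
  have -> : psi x = \sum_(i < N) F i.+1.
    by apply: eq_bigr => i _; rewrite /F expgS mulKg.
  rewrite -sumrB.
  have := telescope_sumr F (leq0n N); rewrite big_mkord /F expg0 mulg1.
  by move=> h; rewrite -[RHS]opprB -h -sumrN; apply: eq_bigr => i _; rewrite opprB.
by case: (x == _); case: (x == _) => /=; lra.
Qed.

(** * Energy and variance along one step of the walk *)

Section Energy.
Variables (R : realType) (G : groupType) (L : finType).
Variables (v : L -> G) (inv : L -> L) (q : R).
Hypothesis invK : involutive inv.
Hypotheses (cardL : #|L|%:R = q + 1) (q2 : 2 <= q).
Implicit Types (f : L -> G -> R) (a b : L) (x y : G).

Definition total f x := \sum_a f a x.

(** The transition for the joint law of last letter and inverse position. Appending [b] moves the
    inverse position from [v b * y] to [y]; the subtracted term removes the forbidden previous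
    letter [inv b], and [q] is the number of letters allowed next. *)
Definition step f b y :=
  (total f (v b * y)%g - f (inv b) (v b * y)%g) / q.

Definition energy f := \sum_b \sum_(x \in [set: G]) f b x ^+ 2.

Definition mean f x := total f x / (q + 1).

Definition variance f := \sum_b \sum_(x \in [set: G]) (f b x - mean f x) ^+ 2.

Let sum_sqr (u : L -> R) (c d : R) :
  \sum_b (c + d * u b) ^+ 2 =
  (q + 1) * c ^+ 2 + 2 * c * d * \sum_b u b + d ^+ 2 * \sum_b u b ^+ 2.
Proof.
under eq_bigr do rewrite sqrrD -mulr_natl exprMn.
rewrite !big_split/= sumr_const; congr (_ + _ + _).
- by rewrite -cardL mulr_natl; congr (_ *+ _); apply: eq_card.
- by rewrite [RHS]mulr_sumr; apply: eq_bigr => b _; ring.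
- by rewrite mulr_sumr.
Qed.

Let common_support f : (forall b, finitely_supported (f b)) ->
  exists D : {fset G}, forall b x, x \notin D -> f b x = 0.
Proof.
move=> /choice[D fD]; exists (\bigcup_(b in L) D b)%fset => b x xD.
apply: fD; apply: contra xD => xD.
by apply/bigfcupP; exists b => //; rewrite mem_index_enum.
Qed.

Let sum_fsum_support (D : {fset G}) (F : L -> G -> R) :
  (forall b x, x \notin D -> F b x = 0) ->
  \sum_b \sum_(x \in [set: G]) F b x = \sum_(x <- D) \sum_b F b x.
Proof.
move=> F0; rewrite exchange_big/=; apply: eq_bigr => b _.
by rewrite (fsbigTE D)// => x; exact: F0.
Qed.

Lemma finitely_supported_total f : (forall b, finitely_supported (f b)) ->
  finitely_supported (total f).
Proof.
by case/common_support => D fD; exists D => x xD; apply: big1 => b _; exact: fD.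
Qed.

Lemma finitely_supported_step f : (forall b, finitely_supported (f b)) ->
  forall b, finitely_supported (step f b).
Proof.
move=> fs b.
apply: (@finitely_supported_shift _ _ (fun x => (total f x - f (inv b) x) / q)).
apply: (@finitely_supported_lift2 _ _ (fun c d => (c - d) / q)) => //.
  by rewrite subr0 mul0r.
exact: finitely_supported_total.
Qed.

Let q0 : q != 0. Proof. by rewrite gt_eqF// (lt_le_trans _ q2). Qed.
Let q10 : q + 1 != 0. Proof. by rewrite gt_eqF// ltr_wpDl// (le_trans _ q2). Qed.

(** Translations and the permutation [inv] preserve the norm. What remains sends [f b x] to
    [mean f x - (f b x - mean f x) / q]: the mean over the letters is kept, and the deviation,
    orthogonal to it, is multiplied by [- q^-1]. *)
Lemma energy_step f : (forall b, finitely_supported (f b)) ->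
  energy (step f) = energy f - (1 - q ^- 2) * variance f.
Proof.
case/common_support => D fD.
have totD x : x \notin D -> total f x = 0.
  by move=> xD; apply: big1 => b _; exact: fD.
have -> : energy (step f) =
    \sum_b \sum_(x \in [set: G]) ((total f x - f b x) / q) ^+ 2.
  rewrite [RHS](reindex_inj (inv_inj invK))/=; apply: eq_bigr => b _.
  exact: (fsum_shift (fun x => ((total f x - f (inv b) x) / q) ^+ 2) (v b)).
rewrite /energy /variance.
rewrite !(@sum_fsum_support D); first last.
- by move=> b x xD; rewrite totD// fD// subrr mul0r expr0n.
- by move=> b x xD; rewrite fD// expr0n.
- by move=> b x xD; rewrite /mean totD// fD// mul0r subrr expr0n.
rewrite mulr_sumr -sumrB; apply: eq_bigr => x _.
have -> : \sum_b ((total f x - f b x) / q) ^+ 2 =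
    \sum_b (total f x / q + (- q^-1) * f b x) ^+ 2.
  by apply: eq_bigr => b _; congr (_ ^+ 2); ring.
have -> : \sum_b (f b x - mean f x) ^+ 2 = \sum_b (- mean f x + 1 * f b x) ^+ 2.
  by apply: eq_bigr => b _; congr (_ ^+ 2); ring.
rewrite !sum_sqr -/(total f x) /mean; field.
by rewrite q0 q10.
Qed.

(** Pythagoras over the letters: the deviations from the mean sum to zero. *)
Lemma energy_mean f : (forall b, finitely_supported (f b)) ->
  (q + 1) * \sum_(x \in [set: G]) mean f x ^+ 2 = energy f - variance f.
Proof.
case/common_support => D fD.
have totD x : x \notin D -> total f x = 0.
  by move=> xD; apply: big1 => b _; exact: fD.
rewrite (fsbigTE D); last by move=> x xD; rewrite /mean totD// mul0r expr0n.
rewrite /energy /variance !(@sum_fsum_support D); first last.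
- by move=> b x xD; rewrite fD// expr0n.
- by move=> b x xD; rewrite /mean totD// fD// mul0r subrr expr0n.
rewrite mulr_sumr -sumrB; apply: eq_bigr => x _.
have -> : \sum_b (f b x - mean f x) ^+ 2 = \sum_b (- mean f x + 1 * f b x) ^+ 2.
  by apply: eq_bigr => b _; congr (_ ^+ 2); ring.
rewrite !sum_sqr -/(total f x) /mean; field.
by rewrite q10.
Qed.

Lemma step_meanE f b x :
  step f b x = mean f (v b * x)%g + (mean f (v b * x)%g - f (inv b) (v b * x)%g) / q.
Proof. by rewrite /step /mean; field; rewrite q0 q10. Qed.

Lemma variance_ge f b : (forall b, finitely_supported (f b)) ->
  \sum_(x \in [set: G]) (f b x - mean f x) ^+ 2 <= variance f.
Proof.
move=> fs; rewrite /variance (bigD1 b)//= lerDl sumr_ge0// => c _.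
by rewrite fsumr_ge0// => x _; exact: sqr_ge0.
Qed.

Lemma finitely_supported_mean f : (forall b, finitely_supported (f b)) ->
  finitely_supported (mean f).
Proof.
by case/finitely_supported_total => D fD; exists D => x /fD xD; rewrite /mean xD mul0r.
Qed.

(** By [step_meanE], [step f b] differs from the translate of [mean f] by a deviation of [f] divided
    by [q], and from [mean (step f)] by a deviation of [step f]. The factor 2 comes from
    [(w - z)^2 <= 2 w^2 + 2 z^2]. *)
Lemma mean_step f b : (forall b, finitely_supported (f b)) ->
  \sum_(x \in [set: G]) (mean (step f) x - mean f (v b * x)%g) ^+ 2 <=
  2 * (variance (step f) + variance f).
Proof.
move=> fs; have fs' := finitely_supported_step fs.
pose g x := 2 * (step f b x - mean (step f) x) ^+ 2.
pose h x := 2 * (f (inv b) x - mean f x) ^+ 2.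
have gs : finitely_supported g.
  apply: (@finitely_supported_lift2 _ _ (fun c d => 2 * (c - d) ^+ 2)) => //.
    by rewrite subrr expr0n mulr0.
  exact: finitely_supported_mean.
have hs : finitely_supported h.
  apply: (@finitely_supported_lift2 _ _ (fun c d => 2 * (c - d) ^+ 2)) => //.
    by rewrite subrr expr0n mulr0.
  exact: finitely_supported_mean.
have hs' := finitely_supported_shift (v b) hs.
apply: (@le_trans _ _ (\sum_(x \in [set: G]) (g x + h (v b * x)%g))).
  apply: ler_fsum.
  - apply: (@finitely_supported_lift2 _ _ (fun c d => (c - d) ^+ 2)) => //.
      by rewrite subrr expr0n.
      exact: finitely_supported_mean.
    by apply: finitely_supported_shift; exact: finitely_supported_mean.
  - by apply: finitely_supported_lift2 => //; rewrite addr0.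
  move=> x; rewrite /g /h [step f b x]step_meanE /=.
  set m := mean f _; set m' := mean _ x; set u := f _ _.
  have -> : m' - m = (m - u) / q - (m + (m - u) / q - m') by ring.
  set z := m + _ - m'; set w := (m - u) / q.
  have : w ^+ 2 <= (u - m) ^+ 2.
    rewrite (_ : (u - m) ^+ 2 = (m - u) ^+ 2); last by ring.
    rewrite /w expr_div_n ler_pdivrMr ?exprn_gt0 ?(lt_le_trans _ q2)//.
    by rewrite ler_peMr ?sqr_ge0// exprn_ege1// (le_trans _ q2)// ler1n.
  have := sqr_ge0 (w + z); nra.
rewrite fsumD// (fsum_shift h) mulrDr.
by apply: lerD; rewrite /g /h -mulr_fsumr ler_pM2l// variance_ge.
Qed.
End Energy.

(** * Exponential decay of the energy over a non-amenable subgroup *)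

Section Gap.
Variables (R : realType) (G : groupType) (L : finType).
Variables (v : L -> G) (inv : L -> L) (q : R).
Hypotheses (invK : involutive inv) (vV : forall a, v (inv a) = (v a)^-1%g).
Hypotheses (cardL : #|L|%:R = q + 1) (q2 : 2 <= q).
Implicit Types (f : L -> G -> R) (a b : L) (x y : G).
Local Notation step := (step v inv q).
Local Notation mean := (mean q).
Local Notation variance := (variance q).

Lemma step_ge0 f : (forall b x, 0 <= f b x) -> forall b x, 0 <= step f b x.
Proof.
move=> f0 b x; rewrite /step divr_ge0 ?(le_trans _ q2)//.
by rewrite /total (bigD1 (inv b))//= addrAC subrr add0r sumr_ge0.
Qed.

Lemma step_support (H : set G) f : subgroup H -> (forall b, H (v b)) ->
  (forall b x, f b x != 0 -> H x) -> forall b x, step f b x != 0 -> H x.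
Proof.
move=> sH Hv Hf b x fx.
suff : H (v b * x)%g.
  by move=> Hvx; rewrite -(mulKg (v b) x); apply: subgroupM => //; exact: subgroupV.
apply: contrapT => nH.
have f0 c : f c (v b * x)%g = 0 by apply/eqP; apply: contra_notT nH => /Hf.
by move/eqP: fx; apply; rewrite /step /total big1 ?f0 ?subrr ?mul0r.
Qed.

Lemma variance_ge0 f : 0 <= variance f.
Proof.
by rewrite sumr_ge0// => b _; rewrite fsumr_ge0// => x _; exact: sqr_ge0.
Qed.

(** Without a gap some [f] loses little energy in two steps, so both [f] and [g = step f] have small
    variance. By [mean_step] for [b] and for [inv b], translation by [v b] then nearly exchanges
    [mean f] and [mean g], so their sum is nearly invariant. *)
Lemma energy_gap (H : set G) :
  subgroup H -> (forall b, H (v b)) -> H `<=` gen (range v) -> ~ amenable R H ->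
  exists delta : R, [/\ 0 < delta, delta < 1 &
    forall f, (forall b, finitely_supported (f b)) -> (forall b x, 0 <= f b x) ->
      (forall b x, f b x != 0 -> H x) ->
      energy (step (step f)) <= (1 - delta) * energy f].
Proof.
move=> sH Hv Hgen nH; apply: contrapT => nogap; apply: nH.
apply: (amenable_almost_invariant Hgen) => eta eta0.
have q1 : 0 < 32 * (q + 1) by rewrite mulr_gt0// ltr_wpDl// (le_trans _ q2).
(* The bound [4^-1] keeps at least half of the energy of [f] in its mean. The factor [32 (q + 1)] is
   the product of [8] from bounding the displacement of [psi] by the variances, [2] from [VV] and
   [2 (q + 1)] from [N2]. *)
pose d : R := Num.min 4^-1 (eta / (32 * (q + 1))).
have d0 : 0 < d by rewrite lt_min invr_gt0 ltr0n divr_gt0.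
have d4 : d <= 4^-1 by rewrite ge_min lexx.
have deta : d * (32 * (q + 1)) <= eta.
  by rewrite -ler_pdivlMr// ge_min lexx orbT.
have {nogap}[f [fs f0 Hf] fE] : exists2 f, [/\ forall b, finitely_supported (f b),
    forall b x, 0 <= f b x & forall b x, f b x != 0 -> H x] &
    (1 - d) * energy f < energy (step (step f)).
  apply: contrapT => nof; apply: nogap; exists d; split => //; first by lra.
  move=> f fs f0 Hf; rewrite leNgt; apply/negP => lt; apply: nof.
  by exists f.
pose g := step f.
have gs : forall b, finitely_supported (g b) by exact: finitely_supported_step.
have g0 : forall b x, 0 <= g b x by exact: step_ge0.
have Hg : forall b x, g b x != 0 -> H x by exact: step_support.
have mean0 h x : (forall b x, 0 <= h b x) -> 0 <= mean h x.
  by move=> h0; rewrite /mean divr_ge0 ?sumr_ge0// ltW// ltr_wpDl// (le_trans _ q2).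
have Hmean h x : (forall b x, h b x != 0 -> H x) -> mean h x != 0 -> H x.
  move=> Hh; apply: contraNP => nHx; rewrite /mean /total big1 ?mul0r// => b _.
  by apply/eqP; apply: contra_notT nHx => /Hh.
have ms := finitely_supported_mean q fs.
have ms' := finitely_supported_mean q gs.
have Eg := energy_step v invK cardL q2 fs; rewrite -/g in Eg.
have Egg := energy_step v invK cardL q2 gs.
set c := 1 - q ^- 2 in Eg Egg.
(* For [q = 1] this constant would vanish, and the energy would give no control over the
   variances. *)
have c34 : 3 / 4 <= c.
  have -> : 3 / 4 = 1 - 4^-1 :> R by lra.
  rewrite lerB// lef_pV2 ?posrE ?exprn_gt0 ?(lt_le_trans _ q2)//.
  by have := q2; nra.
have Vf := variance_ge0 f; have Vg := variance_ge0 g.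
rewrite -/g in fE; set E := energy f in Eg fE.
have cVf : 3 / 4 * variance f <= c * variance f by rewrite ler_wpM2r.
have cVg : 3 / 4 * variance g <= c * variance g by rewrite ler_wpM2r.
have E0 : 0 < E by rewrite -(pmulr_rgt0 _ d0); lra.
have dE0 : 0 < d * E by rewrite mulr_gt0.
have VV : variance f + variance g <= 2 * (d * E) by lra.
pose psi x := mean f x + mean g x.
pose N := \sum_(x \in [set: G]) psi x ^+ 2.
have psis : finitely_supported psi.
  by apply: (@finitely_supported_lift2 _ _ +%R) => //; rewrite addr0.
have N2 : E <= 2 * (q + 1) * N.
  have := energy_mean cardL q2 fs; rewrite -/E => mE.
  (* Both means are nonnegative, so adding [mean g] cannot cancel [mean f]. *)
  have mN : \sum_(x \in [set: G]) mean f x ^+ 2 <= N.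
    apply: ler_fsum.
    - by case: ms => D fD; exists D => x /fD->; rewrite expr0n.
    - by case: psis => D fD; exists D => x /fD->; rewrite expr0n.
    move=> x; rewrite ler_sqr ?nnegrE ?addr_ge0 ?mean0//.
    by rewrite lerDl mean0.
  have : (q + 1) * \sum_(x \in [set: G]) mean f x ^+ 2 <= (q + 1) * N.
    by rewrite ler_pM2l// ltr_wpDl// (le_trans _ q2).
  by nra.
exists psi; split => //.
- move=> x; case: (eqVneq (mean f x) 0) => [mf0|/(Hmean _ _ Hf)//].
  by rewrite /psi mf0 add0r => /(Hmean _ _ Hg).
- rewrite -/N; have := lt_le_trans E0 N2; rewrite pmulr_rgt0// mulr_gt0//.
  by rewrite ltr_wpDl// (le_trans _ q2).
move=> b; rewrite -/N.
have mf := mean_step v inv q2 b fs.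
have mg := mean_step v inv q2 (inv b) fs.
(* The shift turns the estimate for [inv b] into a comparison of [mean g] at [v b * x] with [mean f]
   at [x]. *)
rewrite vV -(fsum_shift _ (v b)) in mg.
have mgE : \sum_(x \in [set: G]) (mean g (v b * x)%g - mean f x) ^+ 2 <=
    2 * (variance g + variance f).
  apply: le_trans mg; rewrite le_eqVlt; apply/orP; left; apply/eqP.
  by apply: eq_fsbigr => x _; rewrite mulKg.
pose h1 x := 2 * (mean g x - mean f (v b * x)%g) ^+ 2.
pose h2 x := 2 * (mean g (v b * x)%g - mean f x) ^+ 2.
have h1s : finitely_supported h1.
  apply: (@finitely_supported_lift2 _ _ (fun c d => 2 * (c - d) ^+ 2)) => //.
    by rewrite subrr expr0n mulr0.
  exact: finitely_supported_shift.
have h2s : finitely_supported h2.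
  apply: (@finitely_supported_lift2 _ _ (fun c d => 2 * (c - d) ^+ 2)) => //.
    by rewrite subrr expr0n mulr0.
  exact: finitely_supported_shift.
have : \sum_(x \in [set: G]) (psi (v b * x)%g - psi x) ^+ 2 <=
    \sum_(x \in [set: G]) (h1 x + h2 x).
  apply: ler_fsum.
  - apply: (@finitely_supported_lift2 _ _ (fun c d => (c - d) ^+ 2)) => //.
      by rewrite subrr expr0n.
    exact: finitely_supported_shift.
  - by apply: finitely_supported_lift2 => //; rewrite addr0.
  move=> x; rewrite /h1 /h2 /psi.
  set a1 := mean f _; set a2 := mean g _; set a3 := mean f _; set a4 := mean g _.
  by have := sqr_ge0 ((a1 - a4) - (a2 - a3)); nra.
have -> : \sum_(x \in [set: G]) (h1 x + h2 x) =
    2 * \sum_(x \in [set: G]) (mean g x - mean f (v b * x)%g) ^+ 2 +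
    2 * \sum_(x \in [set: G]) (mean g (v b * x)%g - mean f x) ^+ 2.
  by rewrite fsumD// !mulr_fsumr.
move=> hh.
have : 32 * (q + 1) * d * N <= eta * N.
  rewrite ler_wpM2r//; last by rewrite mulrC.
  by rewrite fsumr_ge0// => x _; exact: sqr_ge0.
have : d * E <= d * (2 * (q + 1) * N) by rewrite ler_pM2l.
by lra.
Qed.
End Gap.

(** * Words, and counting the induced automorphisms of bounded norm *)

Section Words.
Variables (G : groupType) (T : {fset G}).
Implicit Types (w : seq (letter T)) (a : letter T).

Lemma letter_invK : involutive (@letter_inv G T).
Proof. by move=> [a e]; rewrite /letter_inv negbK. Qed.

Lemma letter_val_inv a : letter_val (letter_inv a) = (letter_val a)^-1%g.
Proof. by case: a => a [] //; rewrite /letter_val/= invgK. Qed.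

Lemma card_letter : #|{: letter T}| = (2 * #|` T|)%N.
Proof. by rewrite card_prod card_bool -cardfE mulnC. Qed.

Lemma word_val_cat w w' : word_val (w ++ w') = (word_val w * word_val w')%g.
Proof. by rewrite /word_val big_cat. Qed.

Lemma word_val_inv w :
  word_val (rev (map (@letter_inv G T) w)) = (word_val w)^-1%g.
Proof.
elim: w => [|a w ih]; first by rewrite /word_val big_nil invg1.
rewrite /= rev_cons -cats1 word_val_cat ih /word_val big_seq1 big_cons.
by rewrite letter_val_inv invgM.
Qed.

Lemma gen_word (x : G) : gen [set` T] x -> exists w : seq (letter T), word_val w = x.
Proof.
move/(_ [set x | exists w : seq (letter T), word_val w = x]); apply.
split=> [|u uT]; last first.
  by exists [:: ([` uT]%fset, false)]; rewrite /word_val big_seq1.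
split=> [|_ _ [w <-] [w' <-]]; first by exists [::]; rewrite /word_val big_nil.
by exists (w ++ rev (map (@letter_inv G T) w')); rewrite word_val_cat word_val_inv.
Qed.

(** A shortest word exists for elements of the generated subgroup, so there [word_length] is not its
    default value. *)
Lemma word_lengthP (x : G) : gen [set` T] x ->
  exists2 w : seq (letter T), size w = word_length T x & word_val w = x.
Proof.
move=> /gen_word [w0 w0x].
pose p n := `[< exists2 w : seq (letter T), size w = n & word_val w = x >].
have pex : exists n, p n by exists (size w0); apply/asboolP; exists w0.
case: (ex_minnP pex) => n /asboolP[w wn wx] nmin.
rewrite /word_length; set A := [set _ | _].
have An : A n.
  split; first by exists w.
  by move=> w' w'x; apply: nmin; apply/asboolP; exists w'.
by have [] := xgetPex 0%N (ex_intro _ n An).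
Qed.

End Words.

Lemma ab_mulC (G : groupType) : commutative (@ab_mul G).
Proof.
move=> a b; rewrite -(ab_repr a) -(ab_repr b) !ab_mulE; apply/abP.
have -> : ((repr a * repr b)^-1 * (repr b * repr a) = [~ repr b, repr a])%g.
  by rewrite invgM /commg /conjg !mulgA.
exact: derived_comm.
Qed.

(** Registered so that [perm_big] can reorder the letters of a word in the abelianization. *)
HB.instance Definition _ (G : groupType) := Monoid.isComLaw.Build
  (abelianization G) (ab_one G) (@ab_mul G)
  (@ab_mulA G) (@ab_mulC G) (@ab_mul1 G).

Lemma ab_word_val (G : groupType) (S : {fset G}) (w : seq (letter S)) :
  ab (word_val w) = \big[@ab_mul G/ab_one G]_(a <- w) ab (letter_val a).
Proof.
elim: w => [|a w ih]; first by rewrite /word_val !big_nil.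
by rewrite /word_val !big_cons -ab_mulE ih.
Qed.

Lemma aut_ab_eq (G : groupType) (S : {fset G}) (f g : aut G) :
  generates S [set: G] -> (forall s : S, ab (f (val s)) = ab (g (val s))) ->
  aut_ab f = aut_ab g.
Proof.
move=> SG fg; apply: aut_ext => x; rewrite -(ab_repr x) !aut_abE.
have : gen [set` S] (repr x) by rewrite SG.
move: (repr x); apply: smallest_sub => [|s sS]; last exact: (fg [` sS]%fset).
split=> [|y z /= fy fz]; first by rewrite /= !aut1.
by rewrite !autM !autV !abM -!ab_invE fy fz.
Qed.

(* In the abelianization a word is determined by how often each letter occurs,
   so balls grow polynomially. *)
Lemma card_aut_ab_ball (G : groupType) (S : {fset G}) (N : nat) :
  generates S [set: G] ->
  exists2 D : {fset aut (abelianization G)},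
    (#|` D| <= N.+1 ^ (#|` S| * (2 * #|` S|)))%N &
    forall f, (aut_norm S f <= N)%N -> aut_ab f \in D.
Proof.
move=> SG.
pose J := {ffun S * letter S -> 'I_N.+1}.
(* The table [j] records, for each generator [s], how often each letter occurs in some word for
   [f s]. Words of length at most [N] have entries at most [N]. *)
pose e (f : aut G) (j : J) := forall s : S, exists2 w : seq (letter S),
  word_val w = f (val s) & forall a, count_mem a w = j (s, a).
(* By [e_eq] any automorphism with table [j] will do; the default [aut_one G] is taken only for
   tables that no automorphism has. *)
pose h (j : J) := aut_ab (xget (aut_one G) [set f | e f j]).
have eP f : (aut_norm S f <= N)%N -> exists j, e f j.
  move=> fN.
  have /choice[w wP] : forall s : S, exists w : seq (letter S),
      (size w <= N)%N /\ word_val w = f (val s).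
    move=> s; have [|w wl wf] := @word_lengthP _ S (f (val s)); first by rewrite SG.
    exists w; split => //; rewrite wl; apply: leq_trans fN.
    exact: (@leq_bigmax _ (fun s : S => word_length S (f (val s)))).
  exists [ffun sa : S * letter S => inord (count_mem sa.2 (w sa.1))] => s.
  exists (w s); first by case: (wP s).
  move=> a; rewrite ffunE inordK// ltnS.
  by apply: leq_trans (count_size _ _) _; case: (wP s).
have e_eq f g j : e f j -> e g j -> aut_ab f = aut_ab g.
  move=> ef eg; apply: (aut_ab_eq SG) => s.
  have [w <- wj] := ef s; have [w' <- w'j] := eg s.
  rewrite !ab_word_val; apply: perm_big.
  by apply/allP => a _ /=; rewrite wj w'j.
exists [fset x in map h (enum J)]%fset.
  rewrite card_fseq; apply: leq_trans (size_undup _) _.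
  by rewrite size_map -cardE card_ffun card_ord card_prod card_letter -cardfE.
move=> f /eP[j ej]; rewrite in_fset; apply/mapP.
exists j; first by rewrite mem_enum.
exact: e_eq ej (@xgetI _ (aut_one G) [set g | e g j] f ej).
Qed.

(** * The law of the inverse walk and its evolution *)

Section Walk.
Variables (R : realType) (d : measure_display) (Omega : measurableType d).
Variable P : probability Omega R.

Lemma measurable_preimage_fin (I : finType) (X : Omega -> I) :
  (forall i, measurable (X @^-1` [set i])) -> forall S, measurable (X @^-1` S).
Proof.
move=> mX S; rewrite (_ : X @^-1` S = \bigcup_(i in S) X @^-1` [set i]).
  by apply: fin_bigcup_measurable => //; exact: finite_finset.
by apply/seteqP; split=> [om Som|om [i Si /= ->]//]; exists (X om).
Qed.

Lemma fine_partition (I : finType) (X : Omega -> I) (C : set Omega) :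
  (forall i, measurable (X @^-1` [set i])) -> measurable C ->
  fine (P C) = \sum_i fine (P (C `&` X @^-1` [set i])).
Proof.
move=> mX mC.
have mCi i : measurable (C `&` X @^-1` [set i]) by exact: measurableI.
rewrite [in LHS](_ : C = \bigcup_(i in [set: I]) (C `&` X @^-1` [set i])); last first.
  by apply/seteqP; split=> [om Com|om [i _ []]//]; exists (X om).
rewrite measure_fin_bigcup//; last 2 first.
- exact: finite_finset.
- by move=> i j _ _ [om [[_ /= <-] [_ /= <-]]].
rewrite (fsbigE (index_enum I))//; last 2 first.
- exact: index_enum_uniq.
- by move=> i _; rewrite mem_index_enum.
rewrite -sum_fine// => [|i _]; last exact: fin_num_measure.
by apply: eq_bigl => i; rewrite in_setT.
Qed.

Variables (G : groupType) (L : finType) (v : L -> G) (inv : L -> L) (q : R).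
Hypothesis invK : involutive inv.
Variable t : nat -> Omega -> L.
Hypothesis tm : forall n a, measurable (t n @^-1` [set a]).
Hypothesis tS : forall n (w : nat -> L) (b : L),
  P [set om | (forall i, (i <= n)%N -> t i om = w i) /\ t n.+1 om = b] =
  ((if b == inv (w n) then 0 else q^-1)%:E *
   P [set om | forall i, (i <= n)%N -> t i om = w i])%E.

Definition product n om : G := (\prod_(0 <= i < n) v (t i om))%g.

(** Letters are indexed from 0, so [t n] is the last of the [n.+1] factors. The inverse is recorded
    because appending a letter then acts on it by left translation. *)
Definition inv_law n (a : L) (x : G) : R :=
  fine (P [set om | t n om = a /\ (product n.+1 om)^-1%g = x]).

Let letters n om : {ffun 'I_n.+1 -> L} := [ffun i : 'I_n.+1 => t i om].

Let prodw n (w : {ffun 'I_n.+1 -> L}) : G :=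
  (\prod_(0 <= i < n.+1) v (w (inord i)))%g.

Let product_letters n om : product n.+1 om = prodw (letters n om).
Proof.
rewrite /product /prodw !big_nat; apply: eq_bigr => i /andP[_ ilt].
by rewrite ffunE inordK.
Qed.

Let letters_eq n w :
  letters n @^-1` [set w] = [set om | forall i, (i <= n)%N -> t i om = w (inord i)].
Proof.
apply/seteqP; split=> om /=.
  by move=> <- i ilt; rewrite ffunE inordK.
by move=> h; apply/ffunP => i; rewrite ffunE h ?inord_val// -ltnS.
Qed.

Let mletters n w : measurable (letters n @^-1` [set w]).
Proof.
rewrite (_ : _ @^-1` _ = \bigcap_(i in [set: 'I_n.+1]) t i @^-1` [set w i]).
  by apply: fin_bigcap_measurable => //; exact: finite_finset.
apply/seteqP; split=> om /=.
  by move=> <- i _; rewrite /= ffunE.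
by move=> h; apply/ffunP => i; rewrite ffunE; exact: h.
Qed.

(** The pair is a function of the first [n.+1] letters, which take finitely many values, so every
    set [S] is allowed. *)
Lemma measurable_product n (S : set (L * G)) :
  measurable [set om | S (t n om, product n.+1 om)].
Proof.
rewrite (_ : [set om | _] = letters n @^-1`
    [set w : {ffun 'I_n.+1 -> L} | S (w ord_max, prodw w)]).
  exact: (measurable_preimage_fin (@mletters n)).
by apply/seteqP; split=> om /=; rewrite product_letters ffunE.
Qed.

Let inv_lawE n a x : inv_law n a x =
  \sum_(w : {ffun 'I_n.+1 -> L})
     ((w ord_max == a) && ((prodw w)^-1%g == x))%:R * fine (P (letters n @^-1` [set w])).
Proof.
rewrite /inv_law (fine_partition (@mletters n)); last first.
  exact: (measurable_product n [set ag | ag.1 = a /\ ag.2^-1%g = x]).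
apply: eq_bigr => w _.
have [/andP[/eqP wa /eqP wx]|nw] := boolP (_ && _).
  rewrite mul1r; congr (fine (P _)); apply/seteqP; split=> om /=; first by case.
  move=> pw; rewrite product_letters pw; split=> //; split=> //.
  by rewrite -wa -pw ffunE.
rewrite mul0r (_ : _ `&` _ = set0) ?measure0//.
apply/seteqP; split=> om //= [[ta px] wE]; case/negP: nw.
by rewrite -wE -px -product_letters ffunE -ta !eqxx.
Qed.

Let finvV a b : (a == inv b) = (b == inv a).
Proof. by apply/eqP/eqP => ->; rewrite invK. Qed.

(** Both sides are sums over the words [w] of length [n.+1]. A word contributes only if
    [(prodw w)^-1 = v b * y], and then with weight [q^-1], or [0] when its last letter is
    [inv b]. *)
Lemma inv_law_step n : inv_law n.+1 = step v inv q (inv_law n).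
Proof.
apply/funext => b; apply/funext => y.
rewrite /step /total !inv_lawE.
under [in RHS]eq_bigr do rewrite inv_lawE.
rewrite exchange_big/= -sumrB mulr_suml.
rewrite -inv_lawE /inv_law (fine_partition (@mletters n)); last first.
  exact: (measurable_product n.+1 [set ag | ag.1 = b /\ ag.2^-1%g = y]).
apply: eq_bigr => w _; rewrite -mulr_suml.
have -> : \sum_a ((w ord_max == a) && ((prodw w)^-1 == v b * y)%g)%:R =
    ((prodw w)^-1 == v b * y)%g%:R :> R.
  rewrite (bigD1 (w ord_max))//= eqxx/= big1 ?addr0// => a.
  by rewrite eq_sym => /negbTE->.
have fE : fine (P (letters n @^-1` [set w] `&` t n.+1 @^-1` [set b])) =
    (if w ord_max == inv b then 0 else q^-1) * fine (P (letters n @^-1` [set w])).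
  have := tS n (fun i => w (inord i)) b.
  rewrite -letters_eq (_ : inord n = ord_max); last first.
    by apply: val_inj; rewrite /= inordK.
  (* [tS] constrains the new letter, [step] the previous one; the two constraints agree because
     [inv] is an involution. *)
  rewrite finvV => h.
  rewrite [X in fine (P X)](_ : _ = [set om |
    (forall i, (i <= n)%N -> t i om = w (inord i)) /\ t n.+1 om = b]).
    by rewrite h fineM// fin_num_measure.
  by rewrite letters_eq.
have [vw|vw] := eqVneq ((prodw w)^-1)%g (v b * y)%g; last first.
  rewrite andbF mul0r subrr mul0r (_ : _ `&` _ = set0) ?measure0//.
  apply/seteqP; split=> om //= [[tb py] pw]; case/eqP: vw.
  rewrite -py /product big_nat_recr//= -/(product n.+1 om).
  by rewrite product_letters pw tb invgM mulVKg.
rewrite andbT mul1r.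
rewrite [X in fine (P X)](_ : _ = letters n @^-1` [set w] `&` t n.+1 @^-1` [set b]).
  rewrite fE; case: (w ord_max == inv b); rewrite ?mul1r ?mul0r ?subrr ?mul0r//.
  by rewrite subr0 mulrC.
apply/seteqP; split=> om /= [].
  by move=> [tb py] pw.
move=> pw tb; split=> //; split=> //.
rewrite /product big_nat_recr//= -/(product n.+1 om).
by rewrite product_letters pw tb invgM vw mulKg.
Qed.

Lemma inv_law_ge0 n a x : 0 <= inv_law n a x.
Proof. by rewrite fine_ge0. Qed.

Lemma inv_law_finite n a : finitely_supported (inv_law n a).
Proof.
exists [fset (prodw w)^-1%g | w in {: {ffun 'I_n.+1 -> L}}]%fset => x xD.
rewrite inv_lawE big1// => w _; case: eqP => [|_]; last by rewrite mul0r.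
case: eqP => [wx|_]; last by rewrite mul0r.
by case/imfsetP: xD; exists w.
Qed.

Lemma inv_law_support (H : set G) n a x : subgroup H -> (forall b, H (v b)) ->
  inv_law n a x != 0 -> H x.
Proof.
move=> sH Hv; apply: contraNP => nHx; apply/eqP.
rewrite /inv_law (_ : [set _ | _] = set0) ?measure0//.
apply/seteqP; split=> om //= [_ px]; case: nHx; rewrite -px.
apply: subgroupV => //; rewrite /product.
elim/big_ind : _ => // [|y z Hy Hz]; first by case: sH.
exact: subgroupM.
Qed.

Let product_inE n (D : {fset G}) :
  fine (P [set om | product n.+1 om \in D]) =
  \sum_(x <- D) \sum_a inv_law n a x^-1%g.
Proof.
have mx x : measurable [set om | product n.+1 om = x].
  exact: (measurable_product n [set ag | ag.2 = x]).
have -> : [set om | product n.+1 om \in D] =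
    \bigcup_(x in [set` D]) [set om | product n.+1 om = x].
  apply/seteqP; split=> [om omD|om [x xD /= ->]//].
  by exists (product n.+1 om).
rewrite measure_fin_bigcup//; last by move=> x y _ _ [om [/= <- <-]].
rewrite -fsbig_seq// -sum_fine; last by move=> x _; exact: fin_num_measure.
apply: eq_bigr => x _.
rewrite (fine_partition (tm n))//; apply: eq_bigr => a _.
congr (fine (P _)); apply/seteqP; split=> om /= [].
  by move=> -> ->.
by move=> ta px; split=> //; apply: invg_inj.
Qed.

(** Cauchy-Schwarz in the additive form [y <= 1/(4c) + c y^2], summed over the [c] pairs of an
    element of [D] and a letter. The constants add up to [1/4], which stays below the probability
    [1/2] to be contradicted. *)
Lemma product_in_le n (D : {fset G}) :
  fine (P [set om | product n.+1 om \in D]) <=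
  4^-1 + (#|` D| * #|L|)%:R * energy (inv_law n).
Proof.
rewrite product_inE; set c : R := _%:R.
have en0 : 0 <= energy (inv_law n).
  by rewrite sumr_ge0// => a _; rewrite fsumr_ge0// => x _; exact: sqr_ge0.
have c0 : 0 <= c by exact: ler0n.
have cE : \sum_(x <- D) \sum_(a : L) 1 = c :> R.
  under eq_bigr do rewrite sumr_const.
  rewrite big_const_seq count_predT iter_addr_0 -mulrnA mulnC.
  by congr (_ *+ (_ * _)); apply: eq_card.
(* The bound [le1] divides by [c]; if there are no pairs, the sum is empty. *)
have [cz|cn0] := eqVneq c 0.
  rewrite cz mul0r addr0; suff -> : \sum_(x <- D) \sum_a inv_law n a x^-1%g = 0.
    by rewrite invr_ge0.
  have := cz; rewrite /c => /eqP; rewrite pnatr_eq0 muln_eq0 => /orP[].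
    by rewrite cardfs_eq0 => /eqP->; rewrite big_seq_fset0.
  by move=> /eqP/card0_eq L0; rewrite big1// => x _; rewrite big1// => a; have := L0 a.
have le1 y : y <= 4^-1 / c * 1 + c * y ^+ 2.
  have cp : 0 < c by rewrite lt_def cn0.
  rewrite -(ler_pM2l cp) mulr1 mulrDr mulrCA divff// mulr1.
  by have := sqr_ge0 (c * y - 2^-1); nra.
apply: (@le_trans _ _ (\sum_(x <- D) \sum_(a : L)
    (4^-1 / c * 1 + c * inv_law n a x^-1%g ^+ 2))).
  by apply: ler_sum => x _; apply: ler_sum => a _.
under eq_bigr do rewrite big_split/= -!mulr_sumr.
rewrite big_split/= -!mulr_sumr cE divfK// lerD2l ler_wpM2l//.
rewrite exchange_big/=; apply: ler_sum => a _.
have fs2 : finitely_supported (fun x => inv_law n a x ^+ 2).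
  by case: (inv_law_finite n a) => E EP; exists E => x /EP->; rewrite expr0n.
rewrite [leRHS](reindex_fsbigT (fun x => x^-1%g)); last first.
  by exists (fun x => x^-1%g) => x; rewrite invgK.
have fs2V : finitely_supported (fun x => inv_law n a x^-1%g ^+ 2).
  case: fs2 => E EP; exists [fset x^-1%g | x in E]%fset => x xE; apply: EP.
  by apply: contra xE => xE; apply/imfsetP; exists x^-1%g; rewrite ?invgK.
pose g x := (x \in D)%:R * inv_law n a x^-1%g ^+ 2.
have -> : \sum_(x <- D) inv_law n a x^-1%g ^+ 2 = \sum_(x \in [set: G]) g x.
  rewrite (fsbigTE D); last by move=> x /negbTE xD; rewrite /g xD mul0r.
  by apply: eq_big_seq => x xD; rewrite /g xD mul1r.
apply: ler_fsum => //.
- by exists D => x /negbTE xD; rewrite /g xD mul0r.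
- by move=> x; rewrite /g; case: (x \in D); rewrite ?mul1r// mul0r sqr_ge0.
Qed.
End Walk.

(** * Numerical and probabilistic estimates, and passage to the abelianization *)

Lemma subexponential_lt_exponential (R : realType) (delta C : R) (m : nat) :
  0 < delta -> delta < 1 -> 0 <= C -> exists2 eps : R, 0 < eps &
  exists K : nat, forall k N : nat, (K <= k)%N ->
    N%:R <= expR (eps * (2 * k).+1%:R) ->
    C * N.+1%:R ^+ m * (1 - delta) ^+ k < 4^-1.
Proof.
(* With this [eps], the [m]-th power of the bound on [N] is at most [exp (delta k / 2 + delta / 4)],
   whereas [(1 - delta)^k <= exp (- delta k)]. A factor [exp (- delta k / 2)] is left over. *)
move=> d0 d1 C0; set eps := delta / (4 * m.+1%:R).
have m0 : 0 < m.+1%:R :> R by rewrite ltr0n.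
have e0 : 0 < eps by rewrite divr_gt0// mulr_gt0.
exists eps => //.
pose B := C * 2 ^+ m * expR (delta / 4).
have B0 : 0 <= B by rewrite !mulr_ge0 ?exprn_ge0 ?expR_ge0.
(* By [exp x >= 1 + x] at [x = delta k / 2], the leftover factor times [B] is below [1/4] once
   [delta k > 8 B]. *)
pose K := Num.bound (8 * B / delta).
have KB : 8 * B < delta * K%:R.
  by rewrite [ltRHS]mulrC -ltr_pdivrMr// archi_boundP// divr_ge0 ?mulr_ge0// ltW.
exists K => k N Kk NE.
have kK : K%:R <= k%:R :> R by rewrite ler_nat.
set X := expR _ in NE.
have X1 : 1 <= X by rewrite -expR0 ler_expR mulr_ge0// ltW.
have h1 : N.+1%:R ^+ m <= 2 ^+ m * X ^+ m.
  rewrite -exprMn; apply: lerXn2r; rewrite ?nnegrE ?mulr_ge0 ?expR_ge0//.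
  by rewrite -natr1; lra.
have h2 : (1 - delta) ^+ k <= expR (- delta) ^+ k.
  by apply: lerXn2r; rewrite ?nnegrE ?expR_ge0 ?expR_ge1Dx// subr_ge0 ltW.
apply: (@le_lt_trans _ _ (C * (2 ^+ m * X ^+ m) * expR (- delta) ^+ k)).
  by rewrite ler_pM ?mulr_ge0 ?exprn_ge0 ?subr_ge0 ?ler_wpM2l// ltW.
have h3 : X ^+ m * expR (- delta) ^+ k <= expR (delta / 4) * (expR (delta * k%:R / 2))^-1.
  rewrite -!expRM_natl -expRN -!expRD ler_expR.
  have : eps * m%:R <= delta / 4.
    rewrite (_ : eps * m%:R = delta / 4 * (m%:R / m.+1%:R)).
      by rewrite ler_piMr ?divr_ge0 ?ler_pdivrMr ?mul1r ?ler_nat// ltW.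
    by rewrite /eps invfM; ring.
  have : (2 * k).+1%:R = 2 * k%:R + 1 :> R by rewrite -natr1 natrM.
  move=> ->; have : 0 <= k%:R :> R by []. 
  set a := eps * m%:R => k0 ha.
  have -> : m%:R * (eps * (2 * k%:R + 1)) = a * (2 * k%:R + 1) by rewrite /a; ring.
  nra.
apply: (@le_lt_trans _ _ (B * (expR (delta * k%:R / 2))^-1)).
  set Y := (expR (delta * k%:R / 2))^-1 in h3 *.
  by rewrite /B -!mulrA ler_wpM2l// ler_wpM2l ?exprn_ge0.
rewrite ltr_pdivrMr ?expR_gt0//.
have := expR_ge1Dx (delta * k%:R / 2).
have : delta * K%:R <= delta * k%:R by rewrite ler_pM2l.
lra.
Qed.

Lemma aut_ab1 (G : groupType) : aut_ab (1%g : aut G) = 1%g.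
Proof. by apply: aut_ext => x; rewrite -(ab_repr x) aut_abE. Qed.

Lemma aut_abM (G : groupType) : {morph @aut_ab G : f g / (f * g)%g}.
Proof. by move=> f g; apply: aut_ext => x; rewrite -(ab_repr x) /= !aut_ab_funE. Qed.

Lemma aut_abV (G : groupType) (f : aut G) : aut_ab f^-1%g = (aut_ab f)^-1%g.
Proof. by apply: (mulgI (aut_ab f)); rewrite -aut_abM !mulgV aut_ab1. Qed.

(** Markov's inequality. Since [nu <= 0], failure of the event puts the normalized logarithm at
    distance at least [eps] from [nu]; the mean distance is eventually below [eps / 2], so failure
    has probability below [1/2]. *)
Lemma growth_small (R : realType) (F : groupType) (T : {fset aut F}) (S : {fset F})
    (d : measure_display) (Omega : measurableType d) (P : probability Omega R)
    (t : nat -> Omega -> letter T) (nu eps : R) :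
  (forall n a, measurable (t n @^-1` [set a])) ->
  growth_constant S P t nu -> nu <= 0 -> 0 < eps ->
  \forall n \near \oo,
    2^-1 <= fine (P [set om | ln (aut_norm S (walk t n.+1 om))%:R < eps * n.+1%:R]).
Proof.
move=> tm [_ /= L1] nu0 e0.
pose X n om : R := ln (aut_norm S (walk t n om))%:R / n%:R.
have X0 n om : 0 <= X n om.
  rewrite divr_ge0//; case: (aut_norm _ _) => [|k]; first by rewrite ln0.
  by rewrite ln_ge0// ler1n.
have mwalk n (B : set (aut F)) : measurable [set om | B (walk t n.+1 om)].
  exact: (measurable_product (@letter_val _ T) tm n [set ag | B ag.2]).
have mX n : measurable_fun setT (X n.+1 : Omega -> measurableTypeR R).
  move=> _ Y mY; rewrite setTI.
  exact: (mwalk n [set g | Y (ln (aut_norm S g)%:R / n.+1%:R)]).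
have mA n : measurable [set om | ln (aut_norm S (walk t n.+1 om))%:R < eps * n.+1%:R].
  exact: (mwalk n [set g | ln (aut_norm S g)%:R < eps * n.+1%:R]).
have e2 : (0 < (eps / 2)%:E :> \bar R)%E by rewrite lte_fin divr_gt0.
have [N _ NP] := L1 _ (open_ereal_lt' e2).
exists N => // n /= Nn; have intn := NP n.+1 (leqW Nn).
rewrite /= -/(X n.+1) in intn.
set A := [set _ | _].
have AcX : ~` A `<=` [set: Omega] `&` [set om | (eps%:E <= `|(X n.+1 om - nu)%:E|)%E].
  move=> om /negP; rewrite -leNgt => ge; split=> //=.
  rewrite lee_fin; apply: le_trans (ler_norm _).
  rewrite lerBrDr (@le_trans _ _ eps)// ?gerDl//.
  by rewrite /X ler_pdivlMr.
pose g om : \bar R := (X n.+1 om - nu)%:E.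
have mg : measurable_fun [set: Omega] g.
  apply/measurable_EFinP; apply: measurable_funB; [exact: mX|exact: measurable_cst].
have mk := @le_integral_comp_abse _ _ _ P [set: Omega] measurableT
  g eps id (@measurable_id _ _ _)
  (fun _ h => h) (fun _ _ _ _ h => h) mg e0.
have mB : measurable ([set: Omega] `&` [set om | (eps%:E <= `|(X n.+1 om - nu)%:E|)%E]).
  apply: emeasurable_fun_c_infty => //.
  exact: measurableT_comp.
have : (eps%:E * P (~` A) < (eps / 2)%:E)%E.
  apply: le_lt_trans intn; apply: le_trans mk.
  apply: lee_wpmul2l; first by rewrite lee_fin ltW.
  by apply: le_measure => //; rewrite inE//; exact/measurableC/mA.
rewrite probability_setC; last exact: mA.
rewrite -(fineK (fin_num_measure P A (mA n))).
rewrite -EFinB -EFinM lte_fin ltr_pM2l//.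
lra.
Qed.

Lemma walk_aut_ab (F : groupType) (T : {fset aut F})
    (d : measure_display) (Omega : measurableType d)
    (t : nat -> Omega -> letter T) (n : nat) (om : Omega) :
  product (fun a => aut_ab (letter_val a)) t n om = aut_ab (walk t n om).
Proof.
by rewrite /walk (big_morph (@aut_ab F) (@aut_abM F) (aut_ab1 F)).
Qed.

Lemma subgroup_aut_ab (F : groupType) (H : set (aut F)) :
  subgroup H -> subgroup [set aut_ab f | f in H].
Proof.
move=> sH; split=> [|_ _ [f Hf <-] [g Hg <-]].
  by exists 1%g; [case: sH|exact: aut_ab1].
exists (f / g)%g; first exact: sH.2.
by rewrite aut_abM aut_abV.
Qed.

Lemma gen_aut_ab (F : groupType) (T : {fset aut F}) (A : set (aut (abelianization F))) :
  subgroup A -> (forall f, f \in T -> A (aut_ab f)) ->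
  [set aut_ab f | f in gen [set` T]] `<=` A.
Proof.
move=> sA TA _ [f Tf <-]; apply: (Tf [set f | A (aut_ab f)]); split=> //=.
split=> /= [|g h Ag Ah]; first by rewrite aut_ab1; case: sA.
by rewrite aut_abM aut_abV; exact: sA.2.
Qed.

(** * Contradiction from a nonpositive growth constant *)

Theorem corollary3 (R : realType) (k : nat) (F : groupType)
    (H : set (aut F)) :
  (2 <= k)%N -> free_of_rank F k ->
  subgroup H -> finitely_generated H ->
  ~ amenable R [set aut_ab f | f in H] ->
  forall (S : {fset F}) (T : {fset aut F}),
    generates S [set: F] -> generates T H ->
    forall (d : measure_display) (Omega : measurableType d)
      (P : probability Omega R) (t : nat -> Omega -> letter T) (nu : R),
      nonbacktracking_letters P t -> growth_constant S P t nu ->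
      (0 < nu)%R.
Proof.
move=> _ _ sH _ nonamenable S T SF TH d Omega P t nu [tm _ tS] growth.
rewrite ltNge; apply/negP => nu0.
set H' := [set aut_ab f | f in H] in nonamenable.
have sH' : subgroup H' by exact: subgroup_aut_ab.
pose v (a : letter T) := aut_ab (letter_val a).
have vV a : v (letter_inv a) = (v a)^-1%g by rewrite /v letter_val_inv aut_abV.
have TinH f : f \in T -> H f by move=> fT; rewrite -TH => K [_]; exact.
have Hv a : H' (v a).
  exists (letter_val a) => //; rewrite /letter_val.
  by case: a.2; [apply: subgroupV => //|]; exact/TinH/valP.
(* With [T] empty there would be no letters, hence no point in [Omega], against total mass 1. *)
have T0 : (0 < #|` T|)%N.
  rewrite cardfs_gt0; apply/negP => /eqP T0.
  have := probability_setT P; rewrite (_ : [set: Omega] = set0) ?measure0.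
    by move=> /eqP; rewrite eqe eq_sym oner_eq0.
  apply/seteqP; split=> om // _; move: (valP (t 0%N om).1).
  by move: (\val _) => f; rewrite T0 in_fset0.
have [T1|T1] := leqP #|` T| 1.
  have /cardfs1P[g Tg] : #|` T| == 1%N by rewrite eqn_leq T1.
  apply: nonamenable; apply: (@cyclic_amenable _ _ _ (aut_ab g)) => //.
    by exists g => //; apply: TinH; rewrite Tg in_fset1.
  rewrite /H' -TH; apply: gen_aut_ab; first exact: gen_subgroup.
  by move=> f; rewrite Tg in_fset1 => /eqP-> K [_]; exact.
pose q : R := (2 * #|` T| - 1)%:R.
have cardL : #|{: letter T}|%:R = q + 1.
  by rewrite card_letter /q natr1 -subSn ?subSS ?subn0// muln_gt0.
have q2 : 2 <= q.
  rewrite /q ler_nat leq_subRL ?muln_gt0//.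
  exact: (leq_trans (isT : 3 <= 2 * 2)%N (leq_mul (leqnn 2) T1)).
have Hgen : H' `<=` gen (range v).
  rewrite /H' -TH; apply: gen_aut_ab; first exact: gen_subgroup.
  by move=> f fT K [_]; apply; exists ([` fT]%fset, false).
have [delta [d0 d1 gap]] :=
  energy_gap (@letter_invK _ T) vV cardL q2 sH' Hv Hgen nonamenable.
pose p n := inv_law P v t n.
have pS n : p n.+1 = step v (@letter_inv _ T) q (p n).
  exact: (inv_law_step _ (@letter_invK _ T) tm tS).
have pE n : energy (p (2 * n)%N) <= (1 - delta) ^+ n * energy (p 0%N).
  elim: n => [|n ih]; first by rewrite expr0 mul1r.
  rewrite mulnS !pS exprS -mulrA.
  apply: (@le_trans _ _ ((1 - delta) * energy (p (2 * n)%N))).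
    apply: gap => [b|b x|b x].
    - exact: inv_law_finite.
    - exact: inv_law_ge0.
    - exact: inv_law_support.
  by rewrite ler_wpM2l// subr_ge0 ltW.
pose m := (#|` S| * (2 * #|` S|))%N.
pose C : R := #|{: letter T}|%:R * energy (p 0%N).
have C0 : 0 <= C.
  rewrite mulr_ge0// sumr_ge0// => a _.
  by rewrite fsumr_ge0// => x _; exact: sqr_ge0.
have [eps eps0 [K small]] := subexponential_lt_exponential m d0 d1 C0.
have [N _ NP] := growth_small tm growth nu0 eps0.
(* Times of the form [2 n] match the two-step gap, and [p (2 n)] describes the walk after [(2 n).+1]
   letters. *)
pose n := maxn N K.
have half := NP (2 * n)%N (leq_trans (leq_maxl _ _) (@leq_pmull n 2 isT)).
pose B := Num.truncn (expR (eps * (2 * n).+1%:R)).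
have BE : B%:R <= expR (eps * (2 * n).+1%:R) by rewrite truncn_le expR_ge0.
have [D cardD DP] := card_aut_ab_ball B SF.
have mS (A : set (aut F)) : measurable [set om | A (walk t (2 * n).+1 om)].
  exact: (measurable_product (@letter_val _ T) tm (2 * n) [set ag | A ag.2]).
have inD : fine (P [set om |
      ln (aut_norm S (walk t (2 * n).+1 om))%:R < eps * (2 * n).+1%:R]) <=
    fine (P [set om | product v t (2 * n).+1 om \in D]).
  have m1 := mS [set f | ln (aut_norm S f)%:R < eps * (2 * n).+1%:R].
  have m2 : measurable [set om | product v t (2 * n).+1 om \in D].
    exact: (measurable_product v tm (2 * n) [set ag | ag.2 \in D]).
  rewrite fine_le ?fin_num_measure//.
  apply: le_measure; rewrite ?inE// => om /= lt; rewrite walk_aut_ab; apply: DP.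
  (* Norm [0] is treated apart, since [expR] undoes [ln] only on positive numbers. *)
  rewrite /B truncn_ge_nat ?expR_ge0//; case: (aut_norm _ _) lt => [_|a lt].
    exact: expR_ge0.
  by rewrite -[leLHS]lnK ?posrE ?ltr0n// ler_expR ltW.
(* This gives [1/2] as a lower bound for [1/4] plus an energy term, and that term turns out to be
   less than [1/4]. *)
have := le_trans half (le_trans inD (product_in_le P v tm (2 * n) D)).
apply/negP; rewrite -ltNge -/(p _).
have Dp : (#|` D| * #|{: letter T}|)%:R * energy (p (2 * n)%N) <=
    C * B.+1%:R ^+ m * (1 - delta) ^+ n.
  have DB : #|` D|%:R <= B.+1%:R ^+ m :> R by rewrite -natrX ler_nat.
  have -> : C * B.+1%:R ^+ m * (1 - delta) ^+ n =
      B.+1%:R ^+ m * #|{: letter T}|%:R * ((1 - delta) ^+ n * energy (p 0%N)).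
    by rewrite /C; ring.
  rewrite natrM ler_pM ?mulr_ge0 ?ler_wpM2r//.
  by rewrite sumr_ge0// => a _; rewrite fsumr_ge0// => x _; exact: sqr_ge0.
have := small n B (leq_maxr _ _) BE.
lra.
Qed.
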